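(* Let $\lambda\in\mathbb{R}$, let $Y$ be a random variable whose moment generating function exists in a neighborhood of the origin, and let $x\in[0,1]$. For all integers $n\ge k\ge 0$, \[ \frac{1}{k!}B_{k,n}^{Y}(x|\lambda)=\binom{x}{k}_{\lambda}\binom{n}{k}\sum_{j=0}^{n-k}\sum_{l=0}^{j}(1-x)^{l}S_{1}(j,l)\,{n-k \brace j}_{Y,\lambda}. \]
   Context: $S_1(n,k)$ are the Stirling numbers of the first kind: $x(x-1)\cdots(x-n+1)=\sum_{k=0}^nS_1(n,k)x^k$. For $\lambda\in\mathbb{R}$, $(x)_{0,\lambda}=1$, $(x)_{n,\lambda}=x(x-\lambda)\cdots(x-(n-1)\lambda)$ for $n\ge1$, $\binom{x}{k}_\lambda=\frac{(x)_{k,\lambda}}{k!}$, and $e_\lambda^x(t)=\sum_{n\ge0}(x)_{n,\lambda}\frac{t^n}{n!}$. For the random variable $Y$, $E[e_\lambda^Y(t)]$ denotes the power series $\sum_{n\ge0}E[(Y)_{n,\lambda}]\frac{t^n}{n!}$ (constant term $1$); for real $a$, $(E[e_\lambda^Y(t)])^a=\sum_{j\ge0}\binom{a}{j}(E[e_\lambda^Y(t)]-1)^j$. The probabilistic degenerate Stirling numbers of the second kind: $\frac{1}{k!}(E[e_\lambda^Y(t)]-1)^k=\sum_{n\ge k}{n\brace k}_{Y,\lambda}\frac{t^n}{n!}$. The probabilistic degenerate Bernstein polynomials: $\frac{1}{k!}(x)_{k,\lambda}t^k(E[e_\lambda^Y(t)])^{1-x}=\sum_{n\ge k}B_{k,n}^{Y}(x|\lambda)\frac{t^n}{n!}$.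 *)

(* Defs.v *)
From HB Require Import structures.
From mathcomp Require Import all_boot all_order all_algebra.
From mathcomp Require Import all_classical all_reals all_analysis.

Set Implicit Arguments.
Unset Strict Implicit.
Unset Printing Implicit Defensive.

Import Order.TTheory GRing.Theory Num.Theory.
Import numFieldNormedType.Exports.

Local Open Scope classical_set_scope.
Local Open Scope ring_scope.

Definition stirling1 (n k : nat) : int :=
  (\prod_(i < n) ('X - (i%:R)%:P) : {poly int})`_k.

Section degenerate.
Context {R : realType}.
Implicit Types (lam x a : R) (n k j : nat).

(* (x)_{n,lam} *)
Definition dfact lam x n : R := \prod_(i < n) (x - i%:R * lam).

(* the lam-binomial coefficient; lam = 1 gives the usual x(x-1)...(x-k+1)/k! *)
Definition dbinom lam x k : R := dfact lam x k / k`!%:R.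

(* Formal power series over R: f stands for \sum_n (f n) t^n. *)
Definition fps := nat -> R.
Implicit Types f g : fps.

Definition fps1 : fps := fun n => (n == 0%N)%:R.
(* t^n *)
Definition fpsX n : fps := fun m => (m == n)%:R.
Definition fps_sub f g : fps := fun n => f n - g n.
Definition fps_scale (c : R) f : fps := fun n => c * f n.
Definition fps_mul f g : fps := fun n => \sum_(i < n.+1) f i * g (n - i)%N.
Definition fps_exp f k : fps := iter k (fps_mul f) fps1.

(* Sum of a locally finite family of power series: for each n only finitely
   many of the F j have a nonzero coefficient at t^n, so that the sum over all
   j is a sum over a finite support. *)
Definition fps_sum (F : nat -> fps) : fps :=
  fun n => \sum_(j \in [set: nat]) F j n.

(* f^a for f with constant term 1 (so that the family below is locally
   finite). *)
Definition fps_powR f a : fps :=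
  fps_sum (fun j => fps_scale (dbinom 1 a j) (fps_exp (fps_sub f fps1) j)).

(* egf c = \sum_n (c n) t^n / n!, and egf_coef recovers c from it. *)
Definition egf (c : nat -> R) : fps := fun n => c n / n`!%:R.
Definition egf_coef f : nat -> R := fun n => n`!%:R * f n.

End degenerate.

Section probabilistic.
Context {d : measure_display} {T : measurableType d} {R : realType}.
Context (P : probability T R) (Y : {RV P >-> R}) (lam : R).

(* E[e_lam^Y(t)]; fine is harmless because the expectations are finite as soon
   as all the moments of Y are, in particular if Y has a moment generating
   function near 0. *)
Definition Edexp : @fps R :=
  egf (fun n => fine ('E_P[(fun w => dfact lam (Y w) n)])%E).

(* The coefficients at n < k are 0, in agreement with a defining sum over
   n >= k; the same holds for pdbernstein. *)
Definition pdstirling2 (n k : nat) : R :=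
  egf_coef (fps_scale (k`!%:R^-1) (fps_exp (fps_sub Edexp fps1) k)) n.

Definition pdbernstein (k n : nat) (x : R) : R :=
  egf_coef
    (fps_scale (k`!%:R^-1 * dfact lam x k)
       (fps_mul (fpsX k) (fps_powR Edexp (1 - x)))) n.

End probabilistic.

(* Main.v *)
Require Import Defs.
From HB Require Import structures.
From mathcomp Require Import all_boot all_order all_algebra.
From mathcomp Require Import all_classical all_reals all_analysis.
From mathcomp Require Import ring.
Import Order.TTheory GRing.Theory Num.Theory.
Import numFieldNormedType.Exports.
Local Open Scope classical_set_scope.
Local Open Scope ring_scope.

(** Since [E[e_lam^Y(t)] - 1] has no constant term, its [j]-th power starts at
    [t^j]; so the coefficient of [t^m] in [(E[e_lam^Y(t)])^a] is a sum over
    [j <= m], where the falling factorial in [binom(a, j)] expands through the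
    Stirling numbers of the first kind and the coefficients of the powers are
    the probabilistic Stirling numbers.  Multiplication by [t^k] shifts the
    index to [m = n - k], and [n! = C(n, k) k! (n - k)!] gives the constant. *)

Section formal_power_series.
Context {R : realType}.
Implicit Types (f : @fps R) (a : R) (m n k j : nat).

(** Both sides are the value at [a] of the polynomial defining [stirling1 j], with its integer
    coefficients mapped into [R]. *)
Lemma stirling1_sum a j :
  \sum_(l < j.+1) a ^+ l * (stirling1 j l)%:~R = dfact 1 a j.
Proof.
rewrite /stirling1; set p : {poly int} := (\prod_(i < j) _).
have size_p : (size (map_poly intr p : {poly R}) <= j.+1)%N.
  by rewrite (leq_trans (size_poly _ _))// size_prod_XsubC [index_enum _]unlock -enumT size_enum_ord.
transitivity (map_poly intr p : {poly R}).[a].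
  rewrite (horner_coef_wide _ size_p); apply: eq_bigr => i _.
  by rewrite coef_map mulrC.
rewrite rmorph_prod horner_prod; apply: eq_bigr => i _.
by rewrite rmorphB/= map_polyX map_polyC/= hornerXsubC mulr1 rmorph_nat.
Qed.

Lemma fps_exp_eq0 f j m : f 0%N = 0 -> (m < j)%N -> fps_exp f j m = 0.
Proof.
move=> f0; elim: j m => // j IH m mj.
(* The index-0 term dies by [f0]; any other leaves degree [m - i.+1 < j] for the [j]-th power. *)
rewrite /fps_exp iterS -/(fps_exp f j) /fps_mul big1// => -[[|i] /= im] _.
  by rewrite f0 mul0r.
rewrite IH ?mulr0// (@leq_trans m)// ltn_subrL.
exact: leq_ltn_trans (leq0n i) im.
Qed.

Lemma fps_powR_coef f a m : f 0%N = 1 ->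
  fps_powR f a m =
    \sum_(j < m.+1) dbinom 1 a j * fps_exp (fps_sub f fps1) j m.
Proof.
move=> f0; rewrite /fps_powR /fps_sum /fps_scale.
rewrite (fsbig_ord _ _ (fun j => dbinom 1 a j * fps_exp (fps_sub f fps1) j m)).
(* Indices [j > m] contribute 0, so the sum over all [j] truncates. *)
apply/esym/fsbig_widen => // j /= [_ /negP]; rewrite -leqNgt => mj.
by rewrite fps_exp_eq0 ?mulr0// /fps_sub /fps1 f0 subrr.
Qed.

Lemma fps_mulX_coef f k n : (k <= n)%N -> fps_mul (fpsX k) f n = f (n - k)%N.
Proof.
move=> kn; rewrite /fps_mul /fpsX (bigD1 (Ordinal (kn : k < n.+1)%N))//=.
rewrite eqxx mul1r big1 ?addr0// => i ik.
suff /negbTE -> : i != k :> nat by rewrite mul0r.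
by apply: contra ik => /eqP ik; apply/eqP/val_inj.
Qed.

End formal_power_series.

(** An empty product is 1 and [P] has total mass 1; this licenses [fps_powR_coef] for [Edexp]. *)
Lemma Edexp0 (d : measure_display) (T : measurableType d) (R : realType)
    (P : probability T R) (Y : {RV P >-> R}) (lam : R) : Edexp Y lam 0 = 1.
Proof.
rewrite /Edexp /egf fact0 divr1.
have -> : (fun w => dfact lam (Y w) 0) = cst 1.
  by apply/funext => w; rewrite /dfact big_ord0.
by rewrite expectation_cst.
Qed.

Theorem theorem2p7 (d : measure_display) (T : measurableType d) (R : realType)
    (P : probability T R) (Y : {RV P >-> R}) (lam x : R) (n k : nat)
    (hmgf : \forall t \near (0 : R), (mmt_gen_fun P Y t < +oo)%E)
    (hx : 0 <= x <= 1) (hkn : (k <= n)%N) :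
  (k`!%:R)^-1 * pdbernstein Y lam k n x =
    dbinom lam x k * ('C(n, k))%:R *
      \sum_(0 <= j < (n - k).+1) \sum_(0 <= l < j.+1)
        (1 - x) ^+ l * (stirling1 j l)%:~R * pdstirling2 Y lam (n - k) j.
Proof.
have fact_neq0 m : m`!%:R != 0 :> R by rewrite pnatr_eq0 -lt0n fact_gt0.
set m := (n - k)%N.
have -> : \sum_(0 <= j < m.+1) \sum_(0 <= l < j.+1)
    (1 - x) ^+ l * (stirling1 j l)%:~R * pdstirling2 Y lam m j =
    m`!%:R * fps_powR (Edexp Y lam) (1 - x) m.
  rewrite fps_powR_coef ?Edexp0// big_mkord mulr_sumr; apply: eq_bigr => j _.
  rewrite big_mkord -mulr_suml stirling1_sum.
  (* The [j!] under [dbinom] is the one in [pdstirling2]. *)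
  by rewrite /pdstirling2 /egf_coef /fps_scale /dbinom mulrCA !mulrA.
rewrite /pdbernstein /egf_coef /fps_scale fps_mulX_coef// -/m.
rewrite -(bin_fact hkn) -/m !natrM /dbinom.
by field.
Qed.
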